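(* For every topological space $X$, the following maps are full, continuous, and Skula dense: 1. the functions $cl$ that map every set to its closure in $X$, from $\mathbb{P} X$ to $\mathcal{H}_{0\mathsf{V}} X$, and from $\mathbb{P}_{\mathrm{fin}} X$ to $\mathcal{H}_{\mathrm{fin}} X$; 2. the inclusion maps from $\mathcal{H}_{\mathrm{fin}} X$ into $\mathcal{H}_{0\mathsf{V}} X$ and from $\mathbb{P}_{\mathrm{fin}} X$ into $\mathbb{P} X$. In particular, for every Noetherian space $X$, $$\mathrm{sob}(\mathbb{P}_{\mathrm{fin}} X) = \mathrm{sob}(\mathcal{H}_{\mathrm{fin}} X) = \mathrm{sob}(\mathbb{P} X) = \mathrm{sob}(\mathcal{H}_{0\mathsf{V}} X) = ||X|| + 1,$$ and $$||\mathbb{P}_{\mathrm{fin}} X|| = ||\mathcal{H}_{\mathrm{fin}} X|| = ||\mathbb{P} X|| = ||\mathcal{H}_{0\mathsf{V}} X||.$$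
   Context: A topological space is Noetherian if every open subset is compact (every open cover has a finite subcover; no separation is required). For a well-founded poset $P$ and $x \in P$, $\mathrm{rk}_P(x) = \sup_{x' < x} (\mathrm{rk}_P(x')+1)$ and the ordinal rank of $P$ is $|P| = \sup_{x \in P} (\mathrm{rk}_P(x)+1)$, where $\sup\emptyset = 0$. $\mathcal{H}_0 X$ is the poset of all closed subsets of $X$ (including $\emptyset$), ordered by inclusion; it is well-founded when $X$ is Noetherian. The stature of a Noetherian space $X$ is $||X|| = |\mathcal{H}_0 X| - 1$, equivalently $||X|| = \mathrm{rk}_{\mathcal{H}_0 X}(X)$. A closed subset $C$ of $X$ is irreducible if it is non-empty and, whenever $C \subseteq F_1 \cup F_2$ with $F_1, F_2$ closed in $X$, we have $C \subseteq F_1$ or $C \subseteq F_2$. $\mathcal{S} X$ is the poset of irreducible closed subsets of $X$, ordered by inclusion. The sobrification rank of a Noetherian space $X$ is $\mathrm{sob}\, X = |\mathcal{S} X|$. The specialization preordering of $X$ is: $x \leq y$ if and only if every open neighborhood of $x$ contains $y$; the closure of $\{x\}$ is the downward closure $\mathop{\downarrow} x$ in this preordering. The lifted Hoare powerspace $\mathcal{H}_{0\mathsf{V}} X$ is the set of all closed subsets of $X$ (including $\emptyset$) with the lower Vietoris topology, which has as subbase the sets $\{F \text{ closed in } X \mid F \cap U \neq \emptyset\}$, $U$ ranging over the open subsets of $X$. $\mathcal{H}_{\mathrm{fin}} X$ is its subspace of finitary closed subsets $\mathop{\downarrow}\{x_1, \ldots, x_n\} = \bigcup_{i=1}^n \mathop{\downarrow}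 x_i$ ($n \in \mathbb{N}$, $x_i \in X$). $\mathbb{P} X$ is the set of all subsets of $X$, with the topology (also called lower Vietoris) generated by the subbasic open sets $\{A \subseteq X \mid A \cap U \neq \emptyset\}$, $U$ open in $X$. $\mathbb{P}_{\mathrm{fin}} X$ is the subspace of $\mathbb{P} X$ consisting of the finite subsets of $X$. A map $f \colon X \to Y$ between topological spaces is full if every open subset $U$ of $X$ can be written as $f^{-1}(V)$ for some open subset $V$ of $Y$. A continuous map $f \colon X \to Y$ is Skula dense if the map $f^{-1} \colon \mathcal{H}_0 Y \to \mathcal{H}_0 X$, $F \mapsto f^{-1}(F)$, is injective. *)

(* Defs.v *)
From HB Require Import structures.
From mathcomp Require Import all_boot all_order.
From mathcomp Require Import all_classical.
From mathcomp Require Import topology.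

Set Implicit Arguments.
Unset Strict Implicit.
Unset Printing Implicit Defensive.

Import Order.TTheory.

Local Open Scope classical_set_scope.

(* [osup A f] stands for the supremum of the [f i + 1], i.e., the least ordinal
   strictly above every [f i].  Distinct terms may represent the same ordinal:
   the equality of ordinals is [oeq], written [=o], not Leibniz equality. *)
Inductive ord : Type := osup (A : Type) (f : A -> ord).

Fixpoint ole (a b : ord) {struct a} : Prop :=
  let: osup A f := a in
  let: osup B g := b in
  forall i : A, exists j : B, ole (f i) (g j).

Definition oeq (a b : ord) : Prop := ole a b /\ ole b a.

Notation "a =o b" := (oeq a b) (at level 70, no associativity).

Definition osucc (a : ord) : ord := osup (fun _ : unit => a).

Lemma ole_refl a : ole a a.
Proof. by elim: a => A f IH /= i; exists i; exact: IH. Qed.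

Lemma ole_trans b a c : ole a b -> ole b c -> ole a c.
Proof.
elim: b a c => B g IH [A f] [C h] /= ab bc i.
by have [j /IH abj] := ab i; have [k /abj] := bc j; exists k.
Qed.

Lemma oeq_refl a : a =o a.
Proof. by split; exact: ole_refl. Qed.

Lemma oeq_sym a b : a =o b -> b =o a.
Proof. by case. Qed.

Lemma oeq_trans b a c : a =o b -> b =o c -> a =o c.
Proof. by move=> [? ?] [? ?]; split; exact: (@ole_trans b). Qed.

Definition well_founded_poset d (P : porderType d) : Prop :=
  well_founded (fun x y : P => (x < y)%O).

Definition rk d (P : porderType d) (wf : well_founded_poset P) : P -> ord :=
  Fix wf (fun _ => ord) (fun x rec =>
    osup (fun y : {y : P | (y < x)%O} => rec (sval y) (svalP y))).

Definition ordinal_rank d (P : porderType d) (wf : well_founded_poset P) : ord :=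
  osup (rk wf).

Lemma rkE d (P : porderType d) (wf : well_founded_poset P) (x : P) :
  rk wf x = osup (fun y : {y : P | (y < x)%O} => rk wf (sval y)).
Proof.
rewrite /rk Fix_eq // => {}x f g fg; congr osup.
by apply/funext => -[y yx]; exact: fg.
Qed.

Section posets_of_closed_sets.
Variable X : topologicalType.

(* The type underlying both the poset H_0 X and the space H_0V X. *)
Definition hoare0 : Type := set_type [set C : set X | closed C].
HB.instance Definition _ := SubChoice.on hoare0.
HB.instance Definition _ :=
  [SubChoice_isSubPOrder of hoare0 by <: with set_display].

Definition irreducible_closed (C : set X) : Prop :=
  [/\ closed C, C !=set0 &
      forall F1 F2 : set X, closed F1 -> closed F2 ->
        C `<=` F1 `|` F2 -> C `<=` F1 \/ C `<=` F2].

Definition irr_closed : Type := set_type [set C : set X | irreducible_closed C].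
HB.instance Definition _ := SubChoice.on irr_closed.
HB.instance Definition _ :=
  [SubChoice_isSubPOrder of irr_closed by <: with set_display].

Definition noetherian : Prop := forall U : set X, open U -> cover_compact U.

Lemma hoare0_ltE (C D : hoare0) : (C < D)%O <-> \val C `<` \val D.
Proof. by rewrite -lt_val; split => [/asboolP|?] //; exact/asboolP. Qed.

Lemma irr_closed_ltE (C D : irr_closed) : (C < D)%O <-> \val C `<` \val D.
Proof. by rewrite -lt_val; split => [/asboolP|?] //; exact/asboolP. Qed.

Definition hoare0_of (C : set X) (clC : closed C) : hoare0 := SigSub (mem_set clC).

Definition hoare0_top : hoare0 := hoare0_of closedT.

End posets_of_closed_sets.

Lemma noetherian_hoare0_wf (X : topologicalType) :
  noetherian X -> well_founded_poset (hoare0 X).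
Proof.
move=> noethX C0; apply: contrapT => nC0.
pose bad := {C : hoare0 X | ~ Acc (fun x y : hoare0 X => (x < y)%O) C}.
have step (C : bad) : {D : bad | (sval D < sval C)%O}.
  apply: cid; case: C => C nC /=; apply: contrapT => noD; apply: nC.
  split => D DC; apply: contrapT => nD; apply: noD.
  by exists (exist _ D nD).
pose s := fix s (n : nat) : bad :=
  if n is m.+1 then sval (step (s m)) else exist _ C0 nC0.
pose F n : set X := \val (sval (s n)).
have F_closed n : closed (F n) by exact: set_mem (valP (sval (s n))).
have F_lt n : F n.+1 `<` F n.
  by apply/hoare0_ltE; exact: (svalP (step (s n))).
have F_dec m n : (m <= n)%N -> F n `<=` F m.
  move=> /subnK <-; elim: (n - m)%N => [//|k IH]; rewrite addSn.
  exact: subset_trans (properW (F_lt _)) IH.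
pose U n := ~` F n.
have U_open n : open (U n) by exact: closed_openC.
have UU_open : open (\bigcup_n U n) by exact: bigcup_open.
have [|D' _ UD'] := noethX _ UU_open nat setT U (fun n _ => U_open n).
  by move=> x [n _ Ux]; exists n.
pose N := \max_(n <- finmap.enum_fset D') n.
have [_ /nonsubset [x [FNx nFx]]] := F_lt N.
have [|n nD' Unx] := UD' x; first by exists N.+1.
apply: Unx; apply: F_dec FNx.
by rewrite /N (big_rem n) //= leq_maxl.
Qed.

Lemma noetherian_irr_closed_wf (X : topologicalType) :
  noetherian X -> well_founded_poset (irr_closed X).
Proof.
move=> noethX.
have irrcl (C : irr_closed X) : closed (\val C) by have [] := set_mem (valP C).
move=> C; have [D DC] : exists D, D = hoare0_of (@irrcl C) by eexists.
elim/(well_founded_ind (noetherian_hoare0_wf noethX)): D C DC => D IH C DC.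
split => C' C'C; apply: IH (erefl (hoare0_of (@irrcl C'))).
by rewrite DC; apply/hoare0_ltE; exact/irr_closed_ltE.
Qed.

Definition sob (X : topologicalType) (noethX : noetherian X) : ord :=
  ordinal_rank (noetherian_irr_closed_wf noethX).

(* Subtracting 1 from the successor ordinal |H_0 X| amounts to taking the rank
   of the largest element X of H_0 X; see [ordinal_rank_hoare0]. *)
Definition stature (X : topologicalType) (noethX : noetherian X) : ord :=
  rk (noetherian_hoare0_wf noethX) (hoare0_top X).

Lemma ordinal_rank_hoare0 (X : topologicalType) (noethX : noetherian X) :
  ordinal_rank (noetherian_hoare0_wf noethX) =o osucc (stature noethX).
Proof.
rewrite /stature; set wf := noetherian_hoare0_wf _.
split=> /= [C|_]; last by exists (hoare0_top X); exact: ole_refl.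
exists tt.
rewrite !rkE => -[D DC] /=.
have DT : (D < hoare0_top X)%O.
  have [_ nCD] := (hoare0_ltE _ _).1 DC; apply/hoare0_ltE; split => // TD.
  by apply: nCD => x _; exact: TD.
by exists (exist _ D DT); exact: ole_refl.
Qed.

Section powerspaces.
Variable X : topologicalType.

Definition powerspace : Type := set X.
HB.instance Definition _ := Choice.on powerspace.
HB.instance Definition _ := isSubBaseTopological.Build powerspace
  (@open X) (fun U : set X => [set A : powerspace | (A : set X) `&` U !=set0]).

Definition finite_powerspace : Type :=
  set_type [set A : powerspace | finite_set (A : set X)].
HB.instance Definition _ := Topological.on finite_powerspace.

Definition lifted_hoare : Type := hoare0 X.
HB.instance Definition _ := Choice.on lifted_hoare.
HB.instance Definition _ := isSubBaseTopological.Build lifted_hoare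
  (@open X)
  (fun U : set X => [set F : lifted_hoare | \val (F : hoare0 X) `&` U !=set0]).

(* [specialization x y] is x <= y in the specialization preordering. *)
Definition specialization (x y : X) : Prop :=
  forall U : set X, open U -> U x -> U y.

Definition down_closure (A : set X) : set X :=
  [set x | exists2 y, A y & specialization x y].

Definition finitary (F : lifted_hoare) : Prop :=
  exists2 E : set X, finite_set E & \val (F : hoare0 X) = down_closure E.

Definition finitary_hoare : Type := set_type [set F : lifted_hoare | finitary F].
HB.instance Definition _ := Topological.on finitary_hoare.

Lemma closure_down_closure (E : set X) :
  finite_set E -> closure E = down_closure E.
Proof.
move=> finE; apply/seteqP; split => [x clEx|x [y Ey xy] V].
  apply: contrapT => nx.
  have ex (y : X) : exists U : set X, [/\ open U, U x & E y -> ~ U y].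
    have [Ey|nEy] := pselect (E y); last by exists setT; split => //; exact: openT.
    apply: contrapT => nU; apply: nx; exists y => // U oU Ux.
    by apply: contrapT => nUy; apply: nU; exists U.
  have [U HU] := choice ex.
  have : nbhs x (\bigcap_(y in E) U y).
    have [D ->] := finite_fsetP.1 finE; apply: filter_bigI => y _.
    by have [oU Ux _] := HU y; exact: open_nbhs_nbhs.
  by move=> /clEx [y [Ey /(_ y Ey)]]; have [_ _] := HU y; apply.
rewrite nbhsE => -[U [oU Ux] UV]; exists y; split => //.
by apply: UV; exact: xy Ux.
Qed.

Definition closure_map (A : powerspace) : lifted_hoare :=
  hoare0_of (@closed_closure X A).

Lemma closure_map_finitary (A : finite_powerspace) :
  finitary (closure_map (set_val A)).
Proof.
have finA := set_mem (valP A).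
by exists (set_val A : set X) => //; exact: closure_down_closure.
Qed.

Definition closure_map_fin (A : finite_powerspace) : finitary_hoare :=
  SigSub (mem_set (closure_map_finitary A)).

Definition hoare_inclusion : finitary_hoare -> lifted_hoare := set_val.

Definition powerspace_inclusion : finite_powerspace -> powerspace := set_val.

End powerspaces.

Definition full_map (X Y : topologicalType) (f : X -> Y) : Prop :=
  forall U : set X, open U -> exists2 V : set Y, open V & U = f @^-1` V.

Definition skula_dense (X Y : topologicalType) (f : X -> Y) : Prop :=
  set_inj [set F : set Y | closed F] (fun F => f @^-1` F).

Definition full_continuous_skula_dense (X Y : topologicalType) (f : X -> Y) : Prop :=
  [/\ full_map f, continuous f & skula_dense f].

(* Main.v *)
Require Import Defs.
From HB Require Import structures.
From mathcomp Require Import finmap all_boot all_order all_classical topology.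

(** Write [hit U] for the subbasic open set of all subsets (of [X], or closed
    in [X]) that meet the open set [U].  A set meets [U] if and only if its
    closure does, so the closure map on all subsets pulls [hit U] back to
    [hit U], and is full and continuous.  The inclusions are full and continuous
    because their domains are subspaces, and the closure map on finite subsets
    inherits both properties by restriction.  The closure maps are onto, hence Skula
    dense.  For the finite subsets inside all subsets, the point is that a set lies in
    an open set only if some finite subset of it already does
    ([nbhs_powerspace_finite]); the finitary closed sets inside all closed sets
    then follow by composing with the closure maps.

    If [f : X -> Y] is full, continuous and Skula dense, then [F |-> f^-1 F] is
    an isomorphism between the lattices of closed subsets of [Y] and [X], so it
    preserves the rank of the largest element ([stature_preimage]),
    irreducibility, and the rank of the poset of irreducible closed sets
    ([sob_preimage]); Noetherianness passes from [Y] to [X].  Everything is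
    thereby reduced to the lifted Hoare powerspace.

    That space is Noetherian by the argument of Alexander's subbase lemma
    ([lifted_hoare_noetherian]): [hit] commutes with unions, and in a
    Noetherian [X] any union of open subsets is that of finitely many of them.
    It is also sober: its irreducible closed subsets are exactly the sets [{F | F `<=` C}] with [C] closed in [X]
    ([irreducible_lifted_hoare]).  These form a copy of the poset of closed
    subsets of [X], whose ordinal rank is the stature of [X] plus one.

    All the arguments about the two subbases go through one principle
    ([subbase_cvg]): a filter converges to [x] as soon as it contains every
    subbasic open set around [x].  Fullness, density, compactness and sobriety
    each amount to a well-chosen filter. *)

Set Implicit Arguments.
Unset Strict Implicit.
Unset Printing Implicit Defensive.

Local Open Scope classical_set_scope.

(** * Ranks of isomorphic posets *)

Section rank_isomorphism.
Context d d' (P : porderType d) (Q : porderType d').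
Variables (wfP : well_founded_poset P) (wfQ : well_founded_poset Q).

Variable h : P -> Q.
Hypothesis h_lt : forall x y, (x < y)%O <-> (h x < h y)%O.
Hypothesis h_surj : forall q, exists p, h p = q.

Lemma rk_iso x : rk wfP x =o rk wfQ (h x).
Proof.
elim/(well_founded_ind wfP): x => x IH; rewrite !rkE; split.
  move=> [y yx]; have [yhy _] := IH y yx.
  by exists (exist _ (h y) ((h_lt y x).1 yx)).
move=> [q]; have [y <-] := h_surj q => hyx.
have yx := (h_lt y x).2 hyx; have [_ hyy] := IH y yx.
by exists (exist _ y yx).
Qed.

Lemma ordinal_rank_iso : ordinal_rank wfP =o ordinal_rank wfQ.
Proof.
split => [x|q]; first by exists (h x); have [] := rk_iso x.
by have [x <-] := h_surj q; exists x; have [] := rk_iso x.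
Qed.

End rank_isomorphism.

(** * Full, continuous and Skula dense maps *)

Section full_maps.
Variables (X Y : topologicalType) (f : X -> Y).

Lemma filter_from_preimage x : Filter (filter_from (nbhs (f x)) (preimage f)).
Proof.
apply: filter_from_filter; first by exists setT; exact: filterT.
by move=> V W fxV fxW; exists (V `&` W) => //; exact: filterI.
Qed.

(** The hypothesis says that [X] carries at most the topology induced by [f];
    stating it as a convergence makes it checkable on a subbase of [X]. *)
Lemma full_map_cvg :
  (forall x, filter_from (nbhs (f x)) (preimage f) --> x) -> full_map f.
Proof.
move=> cvgf U oU.
(* The largest open set whose preimage is contained in [U]. *)
exists (\bigcup_(V in [set V | open V /\ f @^-1` V `<=` U]) V).
  by apply: bigcup_open => V [].
apply/seteqP; split => [x Ux|x [V [_ VU] Vfx]]; last exact: VU.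
have [W + WU] := cvgf x U (open_nbhs_nbhs (conj oU Ux)).
rewrite nbhsE => -[V [oV Vfx] VW]; exists V => //.
by split => // y Vfy; apply/WU/VW.
Qed.

Lemma full_noetherian : full_map f -> noetherian Y -> noetherian X.
Proof.
move=> fullf noethY U _ I D g og Ug.
have ex i : exists V, D i -> open V /\ g i = f @^-1` V.
  have [Di|nDi] := pselect (D i); last by exists setT.
  by have [V oV ->] := fullf _ (og i Di); exists V.
have [V HV] := choice ex.
have oV i : D i -> open (V i) by move=> /HV [].
have [D' D'D VD'] := noethY _ (bigcup_open oV) I D V oV (@subset_refl _ _).
exists D' => // x /Ug [i Di gix].
have [|j D'j Vjfx] := VD' (f x).
  by exists i => //; have [_ gE] := HV i Di; move: gix; rewrite gE.
by exists j => //; have [_ ->] := HV j (set_mem (D'D j D'j)).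
Qed.

Lemma full_closed : full_map f ->
  forall D, closed D -> exists2 F, closed F & D = f @^-1` F.
Proof.
move=> fullf D /closed_openC/fullf [V oV DV].
exists (~` V); first exact: open_closedC.
by rewrite -preimage_setC -DV setCK.
Qed.

Hypothesis fullf : full_map f.
Hypothesis contf : continuous f.
Hypothesis densef : skula_dense f.

Lemma closed_preimage (F : set Y) : closed F -> closed (f @^-1` F).
Proof. by move=> clF; apply: preimage_closed => // x _; exact: contf. Qed.

(** An injective map that preserves binary intersections reflects inclusion,
    since [F `<=` G] means [F `&` G = F]. *)
Lemma skula_dense_subset (F G : set Y) : closed F -> closed G ->
  f @^-1` F `<=` f @^-1` G <-> F `<=` G.
Proof.
move=> clF clG; split => [FG|FG x]; last exact: FG.
apply/setIidPl/densef; [|exact/mem_set|].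
  by apply/mem_set; exact: closedI.
by rewrite preimage_setI; exact/setIidPl.
Qed.

Lemma skula_dense_proper (F G : set Y) : closed F -> closed G ->
  f @^-1` F `<` f @^-1` G <-> F `<` G.
Proof.
by move=> clF clG; rewrite /proper !skula_dense_subset.
Qed.

Lemma preimage_irreducible (C : set Y) : closed C ->
  irreducible_closed (f @^-1` C) <-> irreducible_closed C.
Proof.
move=> clC; split => -[clC' C0 irrC].
  split => //; first by have [x Cfx] := C0; exists (f x).
  move=> F1 F2 clF1 clF2 CF12.
  rewrite -(skula_dense_subset clC clF1) -(skula_dense_subset clC clF2).
  by apply: irrC; [exact: closed_preimage| exact: closed_preimage|];
    move=> x /CF12.
split; first exact: closed_preimage.
  apply/set0P/eqP; rewrite -(preimage_set0 f) => fC0.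
  have /= C0E : C = set0 by apply: densef fC0; apply/mem_set => //; exact: closed0.
  by have [y] := C0; rewrite C0E.
move=> D1 D2 /(full_closed fullf) [F1 clF1 ->] /(full_closed fullf) [F2 clF2 ->].
rewrite -preimage_setU !skula_dense_subset //; last exact: closedU.
exact: irrC.
Qed.

Lemma stature_preimage (noethX : noetherian X) (noethY : noetherian Y) :
  stature noethX =o stature noethY.
Proof.
apply: oeq_sym.
pose h (F : hoare0 Y) : hoare0 X := hoare0_of (closed_preimage (set_mem (valP F))).
have -> : stature noethX = rk (noetherian_hoare0_wf noethX) (h (hoare0_top Y)).
  by congr rk; exact/val_inj.
apply: rk_iso => [F G|D].
  rewrite !hoare0_ltE /= skula_dense_proper //; exact: set_mem (valP _).
have [F clF DE] := full_closed fullf (set_mem (valP D)).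
by exists (hoare0_of clF); apply/val_inj.
Qed.

Lemma sob_preimage (noethX : noetherian X) (noethY : noetherian Y) :
  sob noethX =o sob noethY.
Proof.
apply: oeq_sym.
have irr_cl (C : irr_closed Y) : closed (\val C) by have [] := set_mem (valP C).
have irr_pre (C : irr_closed Y) : irreducible_closed (f @^-1` \val C).
  by apply/preimage_irreducible; [exact: irr_cl|exact: set_mem (valP C)].
pose h (C : irr_closed Y) : irr_closed X := SigSub (mem_set (irr_pre C)).
apply: (@ordinal_rank_iso _ _ _ _ _ _ h) => [C D|D].
  by rewrite !irr_closed_ltE /= skula_dense_proper //; exact: irr_cl.
have irrD := set_mem (valP D).
have [F clF DE] := full_closed fullf (let: And3 clD _ _ := irrD in clD).
have irrF : irreducible_closed F by apply/preimage_irreducible; rewrite -?DE.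
by exists (SigSub (mem_set irrF)); apply/val_inj.
Qed.

End full_maps.

Lemma surjective_skula_dense (Y Z : topologicalType) (f : Y -> Z) :
  (forall z, exists y, f y = z) -> skula_dense f.
Proof.
move=> f_surj F G _ _ FG; apply/seteqP; split => z; have [y <-] := f_surj z.
  by move=> Ffy; rewrite -[G _]/((f @^-1` G) y) -FG.
by move=> Gfy; rewrite -[F _]/((f @^-1` F) y) FG.
Qed.

Lemma set_val_continuous (T : topologicalType) (A : set T) :
  continuous (set_val : set_type A -> T).
Proof. exact: initial_continuous. Qed.

Lemma set_val_full (T : topologicalType) (A : set T) :
  full_map (set_val : set_type A -> T).
Proof. by move=> U [V oV VU]; exists V. Qed.

(** * Convergence and compactness through filters *)

(** The hypothesis on [open] is the description of open sets as unions of
    finite intersections that a topology built from a subbase satisfies by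
    definition.  A filter is closed under those finite intersections. *)
Lemma subbase_cvg (T : topologicalType) (I : choiceType) (D : set I)
    (b : I -> set T) :
  open = [set \bigcup_(B in BB) B | BB in subset^~ (finI_from D b)] ->
  forall (G : set_system T) (x : T), Filter G ->
    (forall i, D i -> b i x -> G (b i)) -> G --> x.
Proof.
move=> openE G x FG Gb V; rewrite nbhsE => -[W [+ Wx] WV].
rewrite openE => -[BB BBfin WE].
move: Wx; rewrite -WE => -[B BBB Bx].
apply: (@filterS _ _ _ B); first by move=> y By; apply/WV; rewrite -WE; exists B.
have [D' D'D BE] := BBfin B BBB.
move: Bx; rewrite -BE => Bx.
apply: filter_bigI => i D'i; apply: Gb; last exact: Bx.
exact/set_mem/D'D.
Qed.

Lemma ultrafilter_cover_compact (T : topologicalType) (K : set T) :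
  (forall F : set_system T, UltraFilter F -> F K ->
     exists2 x, K x & F --> x) ->
  cover_compact K.
Proof.
move=> ultraK I D g og Kg.
have [[x0 _]|/set0P/negP/negPn/eqP ->] := pselect (K !=set0); last first.
  by exists fset0.
(* [compact_cover] is about pointed spaces: a point of [K] makes [T] one. *)
pose T' : ptopologicalType := HB.pack_for ptopologicalType T
  (isPointed.Build T x0).
have cK : @compact T' K.
  rewrite compact_ultra => F UF FK.
  by have [x Kx Fx] := ultraK F UF FK; exists x.
by rewrite (@compact_cover T') in cK; exact: (cK I D g).
Qed.

(** * The lower Vietoris subbases *)

Section powerspaces.
Variable X : topologicalType.

Local Notation PX := (powerspace X).
Local Notation HX := (lifted_hoare X).

Definition pset_hit (U : set X) : set PX := [set A | (A : set X) `&` U !=set0].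
Definition hoare_hit (U : set X) : set HX :=
  [set F | \val (F : hoare0 X) `&` U !=set0].

Lemma cvg_powerspace (G : set_system PX) (A : PX) : Filter G ->
  (forall U, open U -> pset_hit U A -> G (pset_hit U)) -> G --> A.
Proof. by move=> FG; apply: (subbase_cvg (b := pset_hit)). Qed.

Lemma cvg_lifted_hoare (G : set_system HX) (F : HX) : Filter G ->
  (forall U, open U -> hoare_hit U F -> G (hoare_hit U)) -> G --> F.
Proof. by move=> FG; apply: (subbase_cvg (b := hoare_hit)). Qed.

Lemma open_pset_hit U : open U -> open (pset_hit U).
Proof.
move=> oU; exists [set pset_hit U]; last by rewrite bigcup_set1.
by move=> _ ->; exact: finI_from1.
Qed.

Lemma open_hoare_hit U : open U -> open (hoare_hit U).
Proof.
move=> oU; exists [set hoare_hit U]; last by rewrite bigcup_set1.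
by move=> _ ->; exact: finI_from1.
Qed.

(** * The four maps between powerspaces *)

Lemma preimage_hoare_hit U : open U ->
  @closure_map X @^-1` hoare_hit U = pset_hit U.
Proof.
move=> oU; apply/seteqP; split => A /= [x [Ax Ux]].
  exact: Ax (open_nbhs_nbhs (conj oU Ux)).
by exists x; split => //; exact: subset_closure.
Qed.

Lemma closure_map_continuous : continuous (@closure_map X).
Proof.
move=> A; apply: cvg_lifted_hoare => [|U oU clAU].
  exact: (@fmap_filter PX HX (@closure_map X) (nbhs A) _).
rewrite /fmap /= preimage_hoare_hit //.
apply: open_nbhs_nbhs; split; first exact: open_pset_hit.
by rewrite -preimage_hoare_hit.
Qed.

Lemma closure_map_full : full_map (@closure_map X).
Proof.
apply: full_map_cvg => A; apply: cvg_powerspace => [|U oU AU].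
  exact: filter_from_preimage.
exists (hoare_hit U); last by rewrite preimage_hoare_hit.
apply: open_nbhs_nbhs; split; first exact: open_hoare_hit.
by rewrite -preimage_hoare_hit in AU.
Qed.

Lemma closure_map_skula_dense : skula_dense (@closure_map X).
Proof.
apply: surjective_skula_dense => F; exists (\val (F : hoare0 X)); apply/val_inj.
by rewrite /= -(closure_id _).1 //; exact: set_mem (valP F).
Qed.

Lemma closure_map_fin_skula_dense : skula_dense (@closure_map_fin X).
Proof.
apply: surjective_skula_dense => F; have [E finE FE] := set_mem (valP F).
exists (SigSub (mem_set finE)); apply/val_inj/val_inj.
by rewrite FE /= closure_down_closure.
Qed.

Lemma closure_map_fin_full : full_map (@closure_map_fin X).
Proof.
move=> U [V oV <-]; have [W oW ->] := closure_map_full oV.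
exists (@hoare_inclusion X @^-1` W) => //.
by exists W.
Qed.

Lemma closure_map_fin_continuous : continuous (@closure_map_fin X).
Proof.
apply/continuousP => U [W oW <-].
have /continuousP/(_ _ oW) oW' := closure_map_continuous.
by exists (@closure_map X @^-1` W).
Qed.

(** Membership in [hit U] is witnessed by a single point and is inherited by
    supersets; finitely many such conditions need finitely many points.  That
    [V] contains every superset of [E], not just those inside [A], also gives
    that open sets are upward closed. *)
Lemma nbhs_powerspace_finite (A : powerspace X) (V : set (powerspace X)) :
  nbhs A V -> exists E : set X, [/\ finite_set E, E `<=` A &
    forall B : set X, E `<=` B -> V B].
Proof.
pose G := filter_from [set E : set X | finite_set E /\ E `<=` A]
  (fun E => [set B : powerspace X | E `<=` (B : set X)]).
have FG : Filter G.
  apply: filter_from_filter; first by exists set0; split => //; exact: finite_set0.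
  move=> E1 E2 [finE1 E1A] [finE2 E2A]; exists (E1 `|` E2).
    by rewrite /= finite_setU subUset.
  by move=> B /=; rewrite subUset.
have cvgG : G --> A.
  apply: cvg_powerspace => U oU [x [Ax Ux]]; exists [set x].
    by split; [exact: finite_set1|rewrite sub1set; exact/mem_set].
  by move=> B /(_ x erefl) Bx; exists x.
by move=> /cvgG [E [finE EA] EV]; exists E.
Qed.

(** A point [A] of [F] outside [G] yields a finite [E `<=` A] outside [G], and
    [E] is still in [F] because closed sets are downward closed. *)
Lemma powerspace_inclusion_skula_dense : skula_dense (@powerspace_inclusion X).
Proof.
suff sub (F G : set (powerspace X)) : closed F -> closed G ->
    @powerspace_inclusion X @^-1` F `<=` @powerspace_inclusion X @^-1` G ->
    F `<=` G.
  move=> F G /set_mem clF /set_mem clG FG.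
  by apply/seteqP; split; apply: sub => //; rewrite FG.
move=> clF clG FG A FA; apply: contrapT => nGA.
have [|E [finE EA EG]] := @nbhs_powerspace_finite A (~` G).
  by apply: open_nbhs_nbhs; split => //; exact: closed_openC.
have [//|] := EG E.
(* A finite [E'] inside [E] that keeps its supersets, among them [A], out of
   [F] would contradict [FA]. *)
apply: (FG (SigSub (mem_set finE))); apply: contrapT => nFE.
have [|E' [_ E'E E'F]] := @nbhs_powerspace_finite E (~` F).
  by apply: open_nbhs_nbhs; split => //; exact: closed_openC.
by apply: (E'F A) => //; exact: subset_trans EA.
Qed.

(** The composites from the finite subsets of [X] to its closed subsets through
    the finitary closed sets and through all subsets coincide; the latter is
    Skula dense, so closed sets of the lifted Hoare powerspace with equal traces
    on the finitary closed sets are equal. *)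
Lemma hoare_inclusion_skula_dense : skula_dense (@hoare_inclusion X).
Proof.
move=> F G clF clG FG.
apply: closure_map_skula_dense => //.
apply: powerspace_inclusion_skula_dense.
- exact/mem_set/(closed_preimage closure_map_continuous (set_mem _)).
- exact/mem_set/(closed_preimage closure_map_continuous (set_mem _)).
- by rewrite -[LHS]/(@closure_map_fin X @^-1` (@hoare_inclusion X @^-1` F)) FG.
Qed.

(** * Noetherianness of the lifted Hoare powerspace *)

(** Let [F] be an ultrafilter on a set [K] of closed subsets of [X].  The union
    [V] of all open [U] such that [F] avoids [hit U] is a finite union, so [F]
    avoids [hit V] too.  Then [K] has a point [C] outside [hit V], and each
    [hit U] around [C] belongs to [F] since [U] is not contained in [V]: thus [F]
    converges to [C]. *)
Lemma lifted_hoare_noetherian : noetherian X -> noetherian (lifted_hoare X).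
Proof.
move=> noethX K _; apply: ultrafilter_cover_compact => F UF FK.
pose L := [set U : set X | open U /\ ~ F (hoare_hit U)].
have oL U : L U -> open U by case.
have [L' L'L VL'] := noethX _ (bigcup_open oL) _ L id oL (@subset_refl _ _).
pose V := \bigcup_(U in L) U.
have FV : F (~` hoare_hit V).
  have : F (\bigcap_(U in [set` L']) ~` hoare_hit U).
    apply: filter_bigI => U /L'L /set_mem [_ nFU].
    by have [] := in_ultra_setVsetC (hoare_hit U) UF.
  apply: filterS => C CL' [x [Cx /VL' [U L'U Ux]]].
  by apply: (CL' U L'U); exists x.
have [C [KC CV]] := filter_ex (filterI FK FV).
exists C => //; apply: cvg_lifted_hoare => U oU [x [Cx Ux]].
apply: contrapT => nFU; apply: CV; exists x; split => //.
by exists U.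
Qed.

(** * Irreducible closed subsets of the lifted Hoare powerspace *)

(** This is the closure of the point [C] in the lifted Hoare powerspace. *)
Definition closed_subsets (C : hoare0 X) : set (lifted_hoare X) :=
  [set F | \val (F : hoare0 X) `<=` \val C].

Lemma closed_subsetsE (C : hoare0 X) :
  closed_subsets C = ~` hoare_hit (~` \val C).
Proof.
apply/seteqP; split => F /= FC; first by move=> [x [/FC]].
by move=> x Fx; apply: contrapT => nCx; apply: FC; exists x.
Qed.

(** Closed sets are downward closed, because the open sets that contain a
    closed subset of [X] contain all larger ones. *)
Lemma closed_subsets_le (F : set (lifted_hoare X)) (C : hoare0 X) :
  closed F -> F C -> closed_subsets C `<=` F.
Proof.
move=> clF FC D DC; apply: clF => V DV.
suff : principal_filter (C : lifted_hoare X) --> (D : lifted_hoare X).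
  by move=> /(_ V DV) /principal_filterP VC; exists C.
apply: cvg_lifted_hoare => U oU [x [/DC Cx Ux]].
by apply/principal_filterP; exists x.
Qed.

Lemma closed_subsets_irreducible (C : hoare0 X) :
  irreducible_closed (closed_subsets C).
Proof.
split.
- rewrite closed_subsetsE; apply/open_closedC/open_hoare_hit/closed_openC.
  exact: set_mem (valP C).
- by exists C.
- move=> F1 F2 clF1 clF2 CF12.
  have [|FC|FC] := CF12 C; first by [].
    by left; exact: closed_subsets_le.
  by right; exact: closed_subsets_le.
Qed.

(** Sobriety.  [C] is the closure of the union of the members of [F]; what has
    to be shown is [F C].  An open [U] meeting [C] meets some member of [F], so
    [F] meets each subbasic neighborhood of [C].  By irreducibility, the open
    sets that [F] meets are closed under finite intersection and generate a
    filter, which therefore converges to [C]; as [F] is closed, [C] is in it. *)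
Lemma irreducible_lifted_hoare (F : set (lifted_hoare X)) :
  irreducible_closed F -> exists C, closed_subsets C = F.
Proof.
move=> [clF [D0 FD0] irrF].
pose C : hoare0 X :=
  hoare0_of (@closed_closure X (\bigcup_(D in F) \val (D : hoare0 X))).
exists C; apply/seteqP; split => [|D FD]; last first.
  by move=> x Dx; apply: subset_closure; exists D.
apply: closed_subsets_le => //.
pose G := filter_from [set V | open V /\ F `&` V !=set0] id.
have FG : Filter G.
  apply: filter_from_filter; first by exists setT; split; [exact: openT|exists D0].
  move=> V W [oV [A [FA VA]]] [oW [B [FB WB]]]; exists (V `&` W) => //.
  split; first exact: openI.
  apply: contrapT => nFVW.
  have [||E FE|FV|FW] := irrF (~` V) (~` W).
  + exact: open_closedC.
  + exact: open_closedC.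
  + by rewrite -setCI => VWE; apply: nFVW; exists E.
  + exact: FV VA.
  + exact: FW WB.
have cvgG : G --> (C : lifted_hoare X).
  apply: cvg_lifted_hoare => U oU [x [Cx Ux]].
  have [y [[D FD Dy] Uy]] := Cx U (open_nbhs_nbhs (conj oU Ux)).
  exists (hoare_hit U) => //; split; first exact: open_hoare_hit.
  by exists D; split => //; exists y.
apply: clF => V /cvgG [W [_ [D [FD WD]]] WV].
by exists D; split => //; exact: WV.
Qed.

Lemma sob_lifted_hoare (noethX : noetherian X)
    (noethH : noetherian (lifted_hoare X)) :
  sob noethH =o osucc (stature noethX).
Proof.
apply: oeq_trans (ordinal_rank_hoare0 noethX); apply: oeq_sym.
pose h (C : hoare0 X) : irr_closed (lifted_hoare X) :=
  SigSub (mem_set (closed_subsets_irreducible C)).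
have sub (C D : hoare0 X) :
    closed_subsets C `<=` closed_subsets D <-> \val C `<=` \val D.
  by split => [/(_ C)|CD F /subset_trans]; [apply|apply].
apply: (@ordinal_rank_iso _ _ _ _ _ _ h) => [C D|F].
  by rewrite irr_closed_ltE hoare0_ltE /= /proper !sub.
have [C CF] := irreducible_lifted_hoare (set_mem (valP F)).
by exists C; apply/val_inj.
Qed.

End powerspaces.

(** * Stature and sobrification rank of powerspaces *)

Theorem proposition11p4 (X : topologicalType) :
  [/\ full_continuous_skula_dense (@closure_map X),
      full_continuous_skula_dense (@closure_map_fin X),
      full_continuous_skula_dense (@hoare_inclusion X)
    & full_continuous_skula_dense (@powerspace_inclusion X)] /\
  forall noethX : noetherian X,
  exists (noethPfin : noetherian (finite_powerspace X))
         (noethHfin : noetherian (finitary_hoare X))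
         (noethP : noetherian (powerspace X))
         (noethH : noetherian (lifted_hoare X)),
    [/\ sob noethPfin =o sob noethHfin,
        sob noethHfin =o sob noethP,
        sob noethP =o sob noethH
      & sob noethH =o osucc (stature noethX)] /\
    [/\ stature noethPfin =o stature noethHfin,
        stature noethHfin =o stature noethP
      & stature noethP =o stature noethH].
Proof.
have cl_full := @closure_map_full X.
have cl_cont := @closure_map_continuous X.
have cl_dense := @closure_map_skula_dense X.
have clfin_full := @closure_map_fin_full X.
have clfin_cont := @closure_map_fin_continuous X.
have clfin_dense := @closure_map_fin_skula_dense X.
have iH_full : full_map (@hoare_inclusion X) by exact: set_val_full.
have iH_cont : continuous (@hoare_inclusion X) by exact: set_val_continuous.
have iH_dense := @hoare_inclusion_skula_dense X.
have iP_full : full_map (@powerspace_inclusion X) by exact: set_val_full.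
have iP_cont : continuous (@powerspace_inclusion X) by exact: set_val_continuous.
have iP_dense := @powerspace_inclusion_skula_dense X.
split => // noethX.
have noethH := lifted_hoare_noetherian noethX.
have noethP := full_noetherian cl_full noethH.
have noethHfin := full_noetherian iH_full noethH.
have noethPfin := full_noetherian iP_full noethP.
exists noethPfin, noethHfin, noethP, noethH; split; split.
- exact: sob_preimage clfin_full clfin_cont clfin_dense _ _.
- apply: (@oeq_trans (sob noethH)).
    exact: sob_preimage iH_full iH_cont iH_dense _ _.
  by apply: oeq_sym; exact: sob_preimage cl_full cl_cont cl_dense _ _.
- exact: sob_preimage cl_full cl_cont cl_dense _ _.
- exact: sob_lifted_hoare.
- exact: stature_preimage clfin_full clfin_cont clfin_dense _ _.
- apply: (@oeq_trans (stature noethH)).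
    exact: stature_preimage iH_full iH_cont iH_dense _ _.
  by apply: oeq_sym; exact: stature_preimage cl_full cl_cont cl_dense _ _.
- exact: stature_preimage cl_full cl_cont cl_dense _ _.
Qed.
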